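(* For every $d\ge0$ the graph $\Gamma_d=X_{14}\,\square\,H(d,6)$, on $20\cdot6^d$ vertices, admits peak state transfer at time $\pi/3$ with amount $16/225$, independent of $d$. Every group over which $\Gamma_d$ is a Cayley graph surjects onto $F_{20}$; in particular no $\Gamma_d$ is a Cayley graph of an abelian group.
   Context: $F_{20}=\langle a,b\mid a^5=b^4=1,\ bab^{-1}=a^2\rangle$ is the Frobenius group of order $20$. Writing $(i,j)$ for $a^ib^j$, let $$S=\{(0,1),(0,2),(0,3),(1,0),(1,1),(1,2),(1,3),(2,0),(2,3),(3,0),(3,1),(3,3),(4,0),(4,1)\},$$ which is inverse-closed, and let $X_{14}=\mathrm{Cay}(F_{20},S)$, where $\mathrm{Cay}(G,S)$ is the graph with vertex set $G$ and $g\sim h$ if and only if $hg^{-1}\in S$. A graph is a Cayley graph of (or over) a group $K$ if it is isomorphic to $\mathrm{Cay}(K,S')$ for some inverse-closed $S'\subseteq K\setminus\{1_K\}$. $H(d,6)=K_6^{\square d}$ is the Hamming graph ($H(0,6)$ is the one-vertex graph), and $\square$ is the Cartesian product of graphs. For a graph $X$ with adjacency matrix $A=\sum_\theta\theta E_\theta$ (spectral decomposition over distinct eigenvalues, $E_\theta$ the orthogonal projection onto the $\theta$-eigenspace), put $U(t)=\exp(itA)$. $X$ admits peak state transfer from $u$ to $v$ at time $\tau$ if $|U(\tau)_{v,u}|=\sum_\theta|(E_\theta)_{v,u}|$; the amount is then $|U(\tau)_{v,u}|^2$. ''$X$ admits peak state transfer at time $\tau$ with amount $\alpha$'' means that this holds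 for some pair of vertices $u,v$. *)

(* Defs.v *)
From HB Require Import structures.
From mathcomp Require Import all_boot all_order all_fingroup all_algebra.
From mathcomp Require Import complex.
From mathcomp Require Import all_classical all_reals all_analysis.

Set Implicit Arguments.
Unset Strict Implicit.
Unset Printing Implicit Defensive.

Import Order.TTheory GRing.Theory Num.Theory.
Import numFieldNormedType.Exports.

Local Open Scope ring_scope.

Record sgraph := SGraph {
  vertex :> finType;
  adj : rel vertex;
  adj_sym : symmetric adj;
  adj_irr : irreflexive adj }.

Definition graph_iso (X Y : sgraph) : Prop :=
  exists f : X -> Y,
    bijective f /\ forall x y : X, adj (f x) (f y) = adj x y.

Section Complete.
Variable n : nat.

Definition complete_adj : rel 'I_n := fun x y => x != y.

Lemma complete_sym : symmetric complete_adj.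
Proof. by move=> x y; rewrite /complete_adj eq_sym. Qed.

Lemma complete_irr : irreflexive complete_adj.
Proof. by move=> x; rewrite /complete_adj eqxx. Qed.

Definition complete_graph : sgraph := SGraph complete_sym complete_irr.
End Complete.

Section CartesianProduct.
Variables X Y : sgraph.

Definition cartesian_adj : rel (X * Y) := fun p q =>
  (p.1 == q.1) && adj p.2 q.2 || adj p.1 q.1 && (p.2 == q.2).

Lemma cartesian_sym : symmetric cartesian_adj.
Proof.
move=> p q; rewrite /cartesian_adj (eq_sym p.1) (eq_sym p.2).
by rewrite (adj_sym p.1) (adj_sym p.2).
Qed.

Lemma cartesian_irr : irreflexive cartesian_adj.
Proof. by move=> p; rewrite /cartesian_adj !adj_irr andbF. Qed.

Definition cartesian_product : sgraph := SGraph cartesian_sym cartesian_irr.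
End CartesianProduct.

Definition hamming (d q : nat) : sgraph :=
  iter d (cartesian_product (complete_graph q)) (complete_graph 1).

Section Cayley.
Local Open Scope group_scope.
Variables (G : finGroupType) (S : {set G}).

Definition inverse_closed : Prop := {in S, forall s, s^-1 \in S}.

Hypotheses (S1 : 1 \notin S) (SV : inverse_closed).

Definition cayley_adj : rel G := fun g h => h * g^-1 \in S.

Lemma cayley_sym : symmetric cayley_adj.
Proof.
by move=> g h; apply/idP/idP => /SV; rewrite invMg invgK.
Qed.

Lemma cayley_irr : irreflexive cayley_adj.
Proof. by move=> g; rewrite /cayley_adj mulgV; apply/negbTE. Qed.

Definition cayley_graph : sgraph := SGraph cayley_sym cayley_irr.
End Cayley.

Definition is_cayley_graph_over (X : sgraph) (K : finGroupType) : Prop :=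
  exists (S : {set K}) (S1 : (1%g : K) \notin S) (SV : inverse_closed S),
    graph_iso X (cayley_graph S1 SV).

Definition surjects_onto (K G : finGroupType) : Prop :=
  exists f : {morphism [set: K]%SET >-> G}, (f @* [set: K]%SET)%g = [set: G]%SET.

(* [F20Elt i j] is the normal form a^i b^j; the law comes from
   b^j a^k = a^(2^j k) b^j. See [F20_eltE] and [F20_Grp]. *)
Record F20 := F20Elt { F20_fst : 'Z_5; F20_snd : 'Z_4 }.

Section F20Group.
Definition F20_pair (x : F20) := (F20_fst x, F20_snd x).
Definition F20_of_pair p := F20Elt p.1 p.2.
Lemma F20_pairK : cancel F20_pair F20_of_pair.
Proof. by case. Qed.

HB.instance Definition _ := Finite.copy F20 (can_type F20_pairK).

Definition F20_mul (x y : F20) : F20 :=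
  F20Elt (F20_fst x + 2%:R ^+ F20_snd x * F20_fst y)
         (F20_snd x + F20_snd y).
Definition F20_one : F20 := F20Elt 0 0.
Definition F20_inv (x : F20) : F20 :=
  F20Elt (- (2%:R ^+ (- F20_snd x)%R * F20_fst x)) (- F20_snd x).

Lemma F20_expD (j l : 'Z_4) :
  (2%:R : 'Z_5) ^+ (j + l)%R = 2%:R ^+ j * 2%:R ^+ l.
Proof.
have E : (2%:R : 'Z_5) ^+ 4 = 1 by apply/val_inj.
by rewrite -exprD /= (expr_mod _ E).
Qed.

Lemma F20_mulA : associative F20_mul.
Proof.
move=> x y z; rewrite /F20_mul /=; congr F20Elt; last by rewrite addrA.
by rewrite F20_expD mulrDr addrA mulrA.
Qed.

Lemma F20_mul1 : left_id F20_one F20_mul.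
Proof. by case=> i j; rewrite /F20_mul /= !add0r mul1r. Qed.

Lemma F20_mulV : left_inverse F20_one F20_inv F20_mul.
Proof. by case=> i j; rewrite /F20_mul /= !addNr. Qed.

HB.instance Definition _ :=
  Finite_isGroup.Build F20 F20_mulA F20_mul1 F20_mulV.
End F20Group.

Definition F20_a : F20 := F20Elt 1 0.
Definition F20_b : F20 := F20Elt 0 1.

Section F20Theory.
Local Open Scope group_scope.

Lemma F20_eltE (i j : nat) :
  F20_a ^+ i * F20_b ^+ j = F20Elt (i%:R)%R (j%:R)%R.
Proof.
have aE k : F20_a ^+ k = F20Elt (k%:R)%R 0%R.
  elim: k => [|k IHk]; first by [].
  rewrite expgS IHk -[LHS]/(F20_mul _ _) /F20_mul /=.
  by congr F20Elt; rewrite ?addr0 // expr0 mul1r mulrS.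
have bE k : F20_b ^+ k = F20Elt 0%R (k%:R)%R.
  elim: k => [|k IHk]; first by [].
  rewrite expgS IHk -[LHS]/(F20_mul _ _) /F20_mul /=.
  by congr F20Elt; rewrite ?mulr0 ?addr0 // mulrS.
by rewrite aE bE -[LHS]/(F20_mul _ _) /F20_mul /= mulr0 addr0 add0r.
Qed.

Lemma F20_card : #|{: F20}| = 20.
Proof.
rewrite (bij_eq_card (f := F20_pair)) ?card_prod ?card_ord //.
by exists F20_of_pair => [[]|[]].
Qed.

Lemma F20_Grp : [set: F20]%SET \isog
  Grp (a : b : a ^+ 5, b ^+ 4, b * a * b^-1 = a ^+ 2).
Proof.
apply: intro_isoGrp => [|rT H].
  apply/existsP; exists (F20_a, F20_b); rewrite /= !xpair_eqE.
  apply/and4P; split; last first.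
  - by vm_compute.
  - by vm_compute.
  - by vm_compute.
  apply/eqP/setP=> -[i j]; rewrite [RHS]inE.
  rewrite -(natr_Zp i) -(natr_Zp j) -F20_eltE groupM //.
    by rewrite groupX // mem_gen // inE cycle_id.
  by rewrite groupX // mem_gen // inE cycle_id orbT.
case/existsP=> -[x y] /=; rewrite !xpair_eqE => /and4P[/eqP<- /eqP x5 /eqP y4].
move/eqP=> yx.
have yxE : y * x = x ^+ 2 * y by rewrite -yx mulgKV.
have yxn n : y * x ^+ n = x ^+ (2 * n) * y.
  elim: n => [|n IHn]; first by rewrite muln0 !expg0 mulg1 mul1g.
  by rewrite expgSr mulgA IHn -mulgA yxE mulgA -expgD mulnS addnC.
have yjx j n : y ^+ j * x ^+ n = x ^+ (2 ^ j * n) * y ^+ j.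
  elim: j n => [|j IHj] n; first by rewrite mul1n mulg1 mul1g.
  by rewrite expgSr -mulgA yxn mulgA IHj -mulgA expnSr mulnA.
pose f (p : F20) := x ^+ F20_fst p * y ^+ F20_snd p.
have fM : {in [set: F20]%SET &, {morph f : p q / p * q}}.
  move=> [i j] [k l] _ _.
  have Z5E : nat_of_ord (i + 2%:R ^+ j * k)%R = ((i + 2 ^ j * k) %% 5)%N.
    rewrite -natrX -[k in LHS]natr_Zp -natrM -[i in LHS]natr_Zp -natrD.
    by rewrite val_Zp_nat.
  have -> : f (F20Elt i j * F20Elt k l) =
      x ^+ ((i + 2 ^ j * k) %% 5) * y ^+ ((j + l) %% 4).
    by rewrite -Z5E.
  rewrite /f /=.
  rewrite (expg_mod _ x5) (expg_mod _ y4) !expgD -!mulgA; congr (_ * _).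
  by rewrite !mulgA yjx.
apply/homgP; exists (Morphism fM); apply/eqP => /=.
rewrite finset.eqEsubset; apply/andP; split.
  apply/fintype.subsetP=> _ /morphimP[p _ _ ->] /=.
  by rewrite groupM // groupX // mem_gen // inE cycle_id ?orbT.
rewrite join_subG !cycle_subG; apply/andP; split.
  apply/morphimP; exists F20_a; rewrite ?inE //=.
  by rewrite /f /= expg1 mulg1.
apply/morphimP; exists F20_b; rewrite ?inE //=.
by rewrite /f /= expg1 mul1g.
Qed.
End F20Theory.

Definition X14_exponents : seq (nat * nat) :=
  [:: (0, 1); (0, 2); (0, 3); (1, 0); (1, 1); (1, 2); (1, 3);
      (2, 0); (2, 3); (3, 0); (3, 1); (3, 3); (4, 0); (4, 1)]%N.

Definition X14_elements : seq F20 :=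
  [seq (F20_a ^+ ij.1 * F20_b ^+ ij.2)%g | ij <- X14_exponents].

Definition X14_set : {set F20} := [set x in X14_elements]%SET.

Lemma X14_set1 : (1%g : F20) \notin X14_set.
Proof. by rewrite finset.in_set; vm_compute. Qed.

Lemma X14_setV : inverse_closed X14_set.
Proof.
move=> s; rewrite !finset.in_set; apply/allP: s.
by vm_compute.
Qed.

Definition X14 : sgraph := cayley_graph X14_set1 X14_setV.

Definition Gamma (d : nat) : sgraph := cartesian_product X14 (hamming d 6).

Definition expmx (K : numFieldType) (n : nat) (A : 'M[K]_n) : 'M[K]_n :=
  limn (series (fun k => (k`!%:R)^-1 *: A ^+ k)).

(* [eigenspace] and [proj_ortho] act on row vectors. For real symmetric A, the
   only case used below, the theta-eigenspace has a real basis, so this matrix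
   is symmetric and is also the projection acting on column vectors. *)
Definition eigenprojection (C : numClosedFieldType) (n : nat) (A : 'M[C]_n)
    (theta : C) : 'M[C]_n :=
  proj_ortho (eigenspace A theta).

Definition adjacency_mx (C : numClosedFieldType) (X : sgraph) : 'M[C]_#|X| :=
  \matrix_(i, j) (adj (enum_val i) (enum_val j))%:R.

(* Naming the structure on R[i] once makes expressions over it use the
   topology and norm of an arbitrary numClosedFieldType; the topology is not
   found on the bare type R[i]. *)
Definition Cplx (R : realType) : numClosedFieldType := R[i]%C.

Section PeakStateTransfer.
Variables (R : realType) (X : sgraph).

Definition transition_mx (t : R) : 'M[Cplx R]_#|X| :=
  expmx (('i * (t%:C)%C) *: adjacency_mx (Cplx R) X).

Definition transition_amplitude (t : R) (u v : X) : Cplx R :=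
  transition_mx t (enum_rank v) (enum_rank u).

Definition eigenprojection_entry (theta : Cplx R) (u v : X) : Cplx R :=
  eigenprojection (adjacency_mx (Cplx R) X) theta (enum_rank v) (enum_rank u).

(* The sum runs over the finite set of distinct eigenvalues. *)
Definition peak_state_transfer (u v : X) (tau : R) : Prop :=
  `|transition_amplitude tau u v| =
  \sum_(theta \in [set theta | eigenvalue (adjacency_mx (Cplx R) X) theta]%classic)
    `|eigenprojection_entry theta u v|.

Definition admits_peak_state_transfer (tau alpha : R) : Prop :=
  exists u v : X,
    peak_state_transfer u v tau /\
    `|transition_amplitude tau u v| ^+ 2 = (alpha%:C)%C.
End PeakStateTransfer.

(* Main.v *)
From HB Require Import structures.
From Stdlib Require Import BinNat.
Require Import Defs.
From mathcomp Require Import all_boot all_order all_fingroup all_algebra.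
From mathcomp Require Import complex spectral sesquilinear.
From mathcomp Require Import ring lra.
From mathcomp Require Import all_classical all_reals all_analysis.

Set Implicit Arguments.
Unset Strict Implicit.
Unset Printing Implicit Defensive.

Import Order.TTheory GRing.Theory Num.Theory.
Import numFieldNormedType.Exports.

(** The idempotents of a Cartesian product are the tensor products of those of
the factors, and the phases exp(i tau theta) multiply, so peak state transfer at
a common time is inherited by products. At time pi/3 every vertex of K_6 has
peak transfer to itself with amount 1, since its eigenvalues 5 and -1 differ by
6, and X_14 has it from 1 to b: the idempotents of -1, 2 and 14 have
(b, 1)-entries -2/15, 1/12 and 1/20, those of -3 and -2 vanish there, and the
phases agree up to the sign of the entry, whence the amount (4/15)^2.

Adjacent vertices have at least 8 common neighbours in X_14 but only 4 in
H(d,6), so every automorphism of the product preserves the two kinds of edges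
and induces an automorphism of X_14. Colour refinement shows that the stabiliser
of a vertex of X_14 is trivial, so this induced automorphism is a right
translation of F_20; for a group acting regularly on the product, sending an
element to its translation is a homomorphism, which is onto by transitivity. *)

(** * Automorphisms and the two kinds of edges of a Cartesian product *)

Local Open Scope group_scope.

Definition is_automorphism (X : sgraph) (f : X -> X) : Prop :=
  bijective f /\ forall x y : X, adj (f x) (f y) = adj x y.

Definition common_neighbours (X : sgraph) (x y : X) : nat :=
  #|[pred z | adj x z && adj y z]|.

Lemma common_neighbours_automorphism (X : sgraph) (f : X -> X) (x y : X) :
  is_automorphism f -> common_neighbours (f x) (f y) = common_neighbours x y.
Proof.
case=> bij_f f_adj; rewrite /common_neighbours -!sum1_card.
rewrite (reindex f) /=; last exact: onW_bij.
by apply: eq_bigl => z; rewrite !inE !f_adj.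
Qed.

Section Product.
Variables X Y : sgraph.
Local Notation XY := (cartesian_product X Y).

Lemma adj_product_snd (x : X) (h k : Y) :
  adj ((x, h) : XY) (x, k) = adj h k.
Proof. by rewrite /= /cartesian_adj /= eqxx adj_irr orbF. Qed.

Lemma adj_product_fst (x y : X) (h : Y) :
  adj ((x, h) : XY) (y, h) = adj x y.
Proof. by rewrite /= /cartesian_adj /= eqxx adj_irr andbF andbT. Qed.

(** A common neighbour with first coordinate other than [x] would have second coordinate equal to
    both [h] and [k], so all of them lie in the fibre over [x]. *)
Lemma common_neighbours_snd (x : X) (h k : Y) : adj h k ->
  common_neighbours ((x, h) : XY) (x, k) = common_neighbours h k.
Proof.
move=> hk; have inj : injective (pair x : Y -> XY) by move=> ? ? [].
rewrite /common_neighbours -(fintype.card_image inj).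
apply: eq_card => -[a b]; rewrite !inE /= /cartesian_adj /=.
apply/idP/fintype.imageP => [|[c]]; last first.
  by rewrite inE => /andP[hc kc] [-> ->]; rewrite eqxx hc kc.
have [<-|_] := eqVneq x a; last first.
  move=> /= /andP[/andP[_ /eqP hb] /andP[_ /eqP kb]].
  by rewrite hb kb adj_irr in hk.
rewrite !adj_irr !orbF /= => bE; by exists b.
Qed.

Lemma common_neighbours_fst (x y : X) (h : Y) : adj x y ->
  common_neighbours ((x, h) : XY) (y, h) = common_neighbours x y.
Proof.
move=> xy; have inj : injective ((fun z => (z, h)) : X -> XY) by move=> ? ? [].
rewrite /common_neighbours -(fintype.card_image inj).
apply: eq_card => -[a b]; rewrite !inE /= /cartesian_adj /=.
apply/idP/fintype.imageP => [|[c]]; last first.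
  by rewrite inE => /andP[hc kc] [-> ->]; rewrite eqxx !andbT hc kc !orbT.
have [<-|_] := eqVneq h b; last first.
  rewrite !andbF !orbF => /andP[/andP[/eqP xa _] /andP[/eqP ya _]].
  by rewrite xa ya adj_irr in xy.
rewrite !adj_irr !andbF /= !andbT => aE; by exists a.
Qed.

Lemma adj_productP (p q : XY) : adj p q ->
  p.1 = q.1 /\ adj p.2 q.2 \/ adj p.1 q.1 /\ p.2 = q.2.
Proof.
by case/orP=> /andP[]; [move=> /eqP; left | move=> pq /eqP; right].
Qed.

Variable m : nat.
Hypothesis common_X : forall x y : X, adj x y -> (m <= common_neighbours x y)%N.
Hypothesis common_Y : forall h k : Y, adj h k -> (common_neighbours h k < m)%N.

(** Otherwise the image edge would come from [X] and have at least [m] common neighbours, while its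
    source has fewer than [m]. *)
Lemma automorphism_edge_snd (f : XY -> XY) (x : X) (h k : Y) :
  is_automorphism f -> adj h k -> (f (x, h)).1 = (f (x, k)).1.
Proof.
move=> f_aut hk.
have e : adj (f (x, h)) (f (x, k)) by rewrite f_aut.2 adj_product_snd.
have := common_neighbours_automorphism (X := XY) (x, h) (x, k) f_aut.
rewrite common_neighbours_snd //.
case: (adj_productP e) => [[//]|].
case: (f (x, h)) (f (x, k)) => [a b] [c d] /= [ac <-].
by rewrite common_neighbours_fst // => cE; have := common_X ac;
  rewrite cE leqNgt common_Y.
Qed.

Lemma automorphism_edge_fst (f : XY -> XY) (x y : X) (h : Y) :
  is_automorphism f -> adj x y -> adj (f (x, h)).1 (f (y, h)).1.
Proof.
move=> f_aut xy.
have e : adj (f (x, h)) (f (y, h)) by rewrite f_aut.2 adj_product_fst.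
have := common_neighbours_automorphism (X := XY) (x, h) (y, h) f_aut.
rewrite common_neighbours_fst //.
case: (adj_productP e) => [|[//]].
case: (f (x, h)) (f (y, h)) => [a b] [c d] /= [<- bd].
by rewrite common_neighbours_snd // => cE; have := common_Y bd;
  rewrite cE ltnNge common_X.
Qed.

End Product.

(** * Hamming graphs *)

(** Connectedness of the Hamming graph: any two vertices are joined by changing one coordinate at a
    time. *)
Lemma hamming_constant (d q : nat) (T : Type) (g : hamming d q -> T) :
  (forall h k, adj h k -> g h = g k) -> forall h k, g h = g k.
Proof.
elim: d g => [|d IHd] g g_edge; first by move=> h k; rewrite (ord1 h) (ord1 k).
move=> [a h] [b k]; transitivity (g (b, h)).
  have [->//|ab] := eqVneq a b.
  by apply: g_edge; rewrite [adj _ _]adj_product_fst.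
by apply: (IHd (fun h => g (b, h))) => h' k' e; apply: g_edge;
  rewrite [adj _ _]adj_product_snd.
Qed.

Lemma common_neighbours_complete (q : nat) (x y : complete_graph q) :
  adj x y -> common_neighbours x y = (q - 2)%N.
Proof.
move=> xy; have := cardsC [set x; y]; rewrite cards2 [x != y]xy card_ord => cE.
rewrite -[in RHS]cE addKn; apply: eq_card => z.
by rewrite !inE negb_or !(eq_sym z).
Qed.

Lemma common_neighbours_hamming (d q : nat) (h k : hamming d q) :
  adj h k -> common_neighbours h k = (q - 2)%N.
Proof.
elim: d h k => [|d IHd]; first by move=> h k; rewrite (ord1 h) (ord1 k) adj_irr.
move=> [a h] [b k] e; case: (adj_productP e) => /= -[].
  by move=> -> hk; rewrite [LHS]common_neighbours_snd // IHd.
by move=> ab <-; rewrite [LHS]common_neighbours_fst //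
  common_neighbours_complete.
Qed.

Lemma card_hamming (d q : nat) : #|hamming d q| = (q ^ d)%N.
Proof.
elim: d => [|d IHd]; first by rewrite card_ord.
by rewrite [LHS]card_prod IHd card_ord expnS.
Qed.

(** * Colour refinement and the automorphisms of [X14] *)

HB.instance Definition _ := Monoid.isComLaw.Build N 0%num N.add
  N.add_assoc N.add_comm N.add_0_l.

(** One round of colour refinement, with the sum of squares as a hash of the neighbouring colours. A
    linear rule started at 1 in a Cayley graph could not tell x from x^-1, since reversal and
    translation match the walks from 1 to x with those from 1 to x^-1. *)
Definition refine (X : sgraph) (c : X -> N) (x : X) : N :=
  (c x + \big[N.add/0]_(y | adj x y) (c y * c y))%num.

Lemma refine_automorphism (X : sgraph) (f : X -> X) (c : X -> N) :
  is_automorphism f -> c \o f =1 c -> refine c \o f =1 refine c.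
Proof.
move=> [bij_f f_adj] cf x; rewrite /refine /= [c (f x)]cf; congr N.add.
rewrite (reindex f) /=; last exact: onW_bij.
by apply: eq_big => [y|y _]; rewrite ?f_adj // [c (f y)]cf.
Qed.

(** An explicit list, for evaluation; a^i b^j stands at position 4i + j. *)
Definition F20_enum : seq F20 :=
  [seq F20Elt (inZp i) (inZp j) | i <- iota 0 5, j <- iota 0 4].

Lemma mem_F20_enum (x : F20) : x \in F20_enum.
Proof.
case: x => i j; apply/allpairsP; exists (val i, val j).
by split; rewrite ?mem_iota ?ltn_ord //= !valZpK.
Qed.

Lemma F20_enumE : perm_eq (index_enum F20) F20_enum.
Proof.
apply: uniq_perm; rewrite ?index_enum_uniq // => x.
by rewrite mem_index_enum mem_F20_enum.
Qed.

Lemma X14_adjE (x y : X14) :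
  adj x y = ((y : F20) * (x : F20)^-1 \in X14_elements).
Proof. by rewrite /= /cayley_adj finset.in_set. Qed.

Definition X14_adjacent (x y : F20) : bool := (y * x^-1 \in X14_elements).

(* Tabulating the values keeps the iterates of [refine] from being recomputed
   along every walk. *)
Definition X14_refine (c : F20 -> N) : F20 -> N :=
  let t := [seq (c x + foldr N.add 0
     [seq c y * c y | y <- F20_enum & X14_adjacent x y])%num | x <- F20_enum] in
  fun x => nth 0%num t (index x F20_enum).

Lemma X14_refineE (c : X14 -> N) : X14_refine c =1 refine (X := X14) c.
Proof.
move=> x; rewrite /X14_refine (nth_map x) ?index_mem ?mem_F20_enum //.
rewrite nth_index ?mem_F20_enum // /refine.
rewrite (perm_big _ F20_enumE) -[in RHS]big_filter.
have -> : [seq y <- F20_enum | X14_adjacent x y] =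
            [seq y <- F20_enum | @adj X14 x y].
  by apply: eq_filter => y; rewrite [RHS]X14_adjE.
by rewrite foldrE big_map.
Qed.

(** The initial colouring marks 1 alone, so automorphisms fixing 1 preserve it; five rounds suffice
    to separate all twenty elements. *)
Definition X14_colour : F20 -> N :=
  iter 5 X14_refine (fun x => if x == 1 then 1%num else 0%num).

Lemma F20_injective (T : eqType) (c : F20 -> T) :
  uniq [seq c x | x <- F20_enum] -> injective c.
Proof.
move=> c_uniq; apply/injectiveP; rewrite /injectiveb /dinjectiveb.
have enumE : perm_eq (enum {: F20}) F20_enum.
  by rewrite enumT; have := F20_enumE; rewrite [index_enum _]unlock.
by rewrite (perm_uniq (perm_map c enumE)).
Qed.

Lemma X14_colour_inj : injective X14_colour.
Proof. by apply: F20_injective; vm_cast_no_check (erefl true). Qed.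

Lemma X14_stabiliser (f : X14 -> X14) :
  is_automorphism f -> f (1 : F20) = (1 : F20) -> f =1 id.
Proof.
move=> f_aut f1 x; apply: X14_colour_inj.
have step c : c \o f =1 c -> X14_refine c \o f =1 X14_refine c.
  by move=> cf y; rewrite /= !X14_refineE [LHS](refine_automorphism f_aut cf).
suff: X14_colour \o f =1 X14_colour by apply.
rewrite /X14_colour; elim: 5%N => [|n IHn]; last exact: step.
(* Initial colouring: as [f] is injective and fixes 1, [f y] is 1 exactly when [y] is. *)
by move=> y /=; rewrite -[in LHS]f1 (bij_eq f_aut.1).
Qed.

(** Right translations preserve h g^-1, so [f] followed by translation by [u^-1] is an automorphism
    fixing 1, hence the identity. *)
Lemma X14_automorphism (f : X14 -> X14) (x : F20) :
  is_automorphism f -> f x = x * f (1 : F20) :> F20.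
Proof.
move=> [[f' fK f'K] f_adj]; pose u : F20 := f (1 : F20).
have g_aut : is_automorphism ((fun y : X14 => (f y : F20) * u^-1) : X14 -> X14).
  split; last first.
    move=> y z.
    by rewrite [LHS]X14_adjE invMg invgK mulgA mulgKV -X14_adjE f_adj.
  exists ((fun y : F20 => f' (y * u)) : X14 -> X14) => y.
    by rewrite mulgKV fK.
  by rewrite f'K mulgK.
have /(_ x) := X14_stabiliser g_aut (mulgV u).
by move=> xE; rewrite -[in RHS]xE mulgKV.
Qed.

Lemma X14_common_neighbours (x y : X14) :
  adj x y -> (8 <= common_neighbours x y)%N.
Proof.
have: all (fun x => all (fun y => X14_adjacent x y ==>
  (7 < count (fun z => X14_adjacent x z && X14_adjacent y z) F20_enum)%N)
  F20_enum) F20_enum by vm_compute.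
move=> /allP/(_ x (mem_F20_enum x))/allP/(_ y (mem_F20_enum y)).
rewrite /X14_adjacent -X14_adjE => /implyP xy /xy.
suff -> : common_neighbours x y =
    count (fun z => X14_adjacent x z && X14_adjacent y z) F20_enum by [].
rewrite /common_neighbours -sum1_card (perm_big _ F20_enumE) sum1_count.
by apply: eq_count => z; rewrite inE !X14_adjE.
Qed.

(** * Automorphisms of [Gamma] and the surjection onto [F20] *)

Lemma Gamma_automorphism_fst (d : nat) (f : Gamma d -> Gamma d) (x : F20) h k :
  is_automorphism f ->
  (f ((x, h) : Gamma d)).1 = x * (f ((1 : F20, k) : Gamma d)).1 :> F20.
Proof.
move=> f_aut.
(* Adjacent vertices of H(d,6) have 6 - 2 = 4 common neighbours. *)
have common_H (h' k' : hamming d 6) : adj h' k' ->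
    (common_neighbours h' k' < 8)%N by move/common_neighbours_hamming->.
have fst_const y h' k' : (f ((y, h') : Gamma d)).1 = (f ((y, k') : Gamma d)).1.
  apply: (hamming_constant (g := fun i => (f ((y, i) : Gamma d)).1)).
  move=> {}h' {}k'.
  exact: (automorphism_edge_snd X14_common_neighbours common_H).
rewrite (fst_const x h k).
pose s (g : Gamma d -> Gamma d) (y : X14) : X14 := (g (y, k)).1.
suff s_aut : is_automorphism (s f) by apply: (X14_automorphism x s_aut).
case: (f_aut) => -[f' fK f'K] f_adj.
(* The same constancy for the inverse [f'] shows that [s f'] is the inverse of the induced map
   [s f]. *)
have f'_aut : is_automorphism f'.
  by split=> [|p q]; [exists f | rewrite -f_adj !f'K].
have f'_const y h' k' : (f' ((y, h') : Gamma d)).1 = (f' ((y, k') : Gamma d)).1.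
  apply: (hamming_constant (g := fun i => (f' ((y, i) : Gamma d)).1)).
  move=> {}h' {}k'.
  exact: (automorphism_edge_snd X14_common_neighbours common_H).
have sK : cancel (s f) (s f').
  by move=> y; rewrite /s (f'_const _ k (f (y, k)).2) -surjective_pairing fK.
have s'K : cancel (s f') (s f).
  by move=> y; rewrite /s (fst_const _ k (f' (y, k)).2) -surjective_pairing f'K.
split; first by exists (s f').
have edge g y z : is_automorphism g -> adj y z -> adj (s g y) (s g z).
  exact: (automorphism_edge_fst X14_common_neighbours common_H).
move=> y z; apply/idP/idP => [/(edge f' _ _ f'_aut)|/(edge f _ _ f_aut) //].
by rewrite !sK.
Qed.

Lemma Gamma_cayley_surjects (d : nat) (K : finGroupType) :
  is_cayley_graph_over (Gamma d) K -> surjects_onto K F20.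
Proof.
case=> S [S1 [SV [f [[f' fK f'K] f_adj]]]].
have h0 : hamming d 6.
  by elim: (d) => [|n IHn]; [exact: ord0 | exact: (ord0, IHn)].
(* Right multiplication by [k], transported to [Gamma d]. *)
pose T (k : K) (p : Gamma d) : Gamma d := f' (f p * k).
have T_aut k : is_automorphism (T k).
  split; first by exists (T k^-1) => p; rewrite /T f'K ?mulgK ?mulgKV fK.
  move=> p q; rewrite -f_adj -[RHS]f_adj !f'K /= /cayley_adj.
  by rewrite invMg mulgA mulgK.
(* By [Gamma_automorphism_fst], [T k] acts on first coordinates as right translation by [phi k]. *)
pose phi (k : K) : F20 := (T k (1 : F20, h0)).1.
have phiM : {in [set: K]%SET &, {morph phi : k l / k * l}}.
  move=> k l _ _; rewrite {1}/phi.
  (* [T (k * l)] applies [T k] first, and right translations compose in the same order, so [phi]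
     does not reverse products. *)
  have -> : T (k * l) (1 : F20, h0) = T l (T k (1 : F20, h0)).
    by rewrite /T f'K mulgA.
  rewrite [T k _]surjective_pairing.
  by rewrite (Gamma_automorphism_fst _ _ h0 (T_aut l)).
exists (Morphism phiM); apply/setP=> g; rewrite inE; apply/morphimP.
(* This element of [K] moves [(1, h0)] to [(g, h0)]. *)
exists ((f (1 : F20, h0))^-1 * f (g, h0)); rewrite ?inE //=.
by rewrite /phi /T mulKVg fK.
Qed.

Lemma F20_nonabelian : ~~ abelian [set: F20]%SET.
Proof.
apply/negP => /centsP/(_ F20_a (finset.in_setT _) F20_b (finset.in_setT _))/eqP.
by vm_compute.
Qed.

Lemma surjects_onto_nonabelian (K G : finGroupType) :
  surjects_onto K G -> ~~ abelian [set: G]%SET -> ~~ abelian [set: K]%SET.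
Proof. by case=> f <-; apply: contra; apply: morphim_abelian. Qed.

(* Spectral resolutions and the matrix exponential *)
Local Close Scope group_scope.

Local Open Scope classical_set_scope.
Local Open Scope ring_scope.
Local Open Scope sesquilinear_scope.

Section Eigenprojection.
Variables (C : numClosedFieldType) (n : nat) (A : 'M[C]_n) (I : finType).
Variables (th : I -> C) (Q : I -> 'M[C]_n).
Hypothesis QA : forall i, Q i *m A = th i *: Q i.
Hypothesis AQ : forall i, A *m Q i = th i *: Q i.
Hypothesis sumQ : \sum_i Q i = 1%:M.
Hypothesis Qherm : forall i, (Q i) ^t* = Q i.

(** Evaluating [W *m A *m Q i] in two ways multiplies [W *m Q i] by [a] and by [th i]. *)
Lemma eigenvector_mul_resolution m (W : 'M[C]_(m, n)) (a : C) (i : I) :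
  W *m A = a *: W -> th i != a -> W *m Q i = 0.
Proof.
move=> WA ia; have /eqP : th i *: (W *m Q i) = a *: (W *m Q i).
  by rewrite [in RHS]scalemxAl -WA -mulmxA AQ -scalemxAr.
by rewrite -subr_eq0 -scalerBl scaler_eq0 subr_eq0 (negPf ia) => /eqP.
Qed.

Lemma eigenvector_mul_sum m (W : 'M[C]_(m, n)) (a : C) :
  W *m A = a *: W -> W *m \sum_(i | th i == a) Q i = W.
Proof.
move=> WA; rewrite -[RHS]mulmx1 -sumQ [in RHS](bigID (fun i => th i == a)) /=.
rewrite [in RHS]mulmxDr [X in _ = _ + X]mulmx_sumr.
rewrite [X in _ = _ + X]big1 ?addr0 //.
by move=> i; apply: eigenvector_mul_resolution.
Qed.

Lemma eigenvalue_resolution (a : C) : eigenvalue A a -> exists i, th i = a.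
Proof.
case/eigenvalueP=> v vA v0; apply/existsPP; first by move=> i; exact: eqP.
apply: contraNT v0; rewrite negb_exists => /forallP noa.
by rewrite -(eigenvector_mul_sum vA) big_pred0 ?mulmx0 // => i; apply/negbTE.
Qed.

(** Let M be the sum and P the projection. The rows of P are eigenvectors, so P M = P; M is
    Hermitian with rows in the eigenspace, to which the rows of 1 - P are orthogonal, so (1 - P) M =
    0. Adding gives M = P. *)
Lemma eigenprojection_resolution (a : C) :
  eigenprojection A a = \sum_(i | th i == a) Q i.
Proof.
rewrite /eigenprojection; set E := eigenspace A a; set M := \sum_(i | _) _.
have ME : (M <= E)%MS.
  apply/eigenspaceP; rewrite mulmx_suml scaler_sumr.
  by apply: eq_bigr => i /eqP <-; rewrite QA.
have M_herm : M ^t* = M.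
  rewrite linear_sum /= raddf_sum /=.
  by apply: eq_bigr => i _; rewrite Qherm.
have PM : proj_ortho E *m M = proj_ortho E.
  apply: eigenvector_mul_sum; apply/eigenspaceP.
  by rewrite -[proj_ortho E]mul1mx proj_ortho_sub.
have PcM : (1%:M - proj_ortho E) *m M = 0.
  have := proj_ortho_compl_sub E 1%:M; rewrite mul1mx => /orthomx1P W0.
  have [D MD] := submxP ME.
  by rewrite -M_herm MD trmx_mul map_mxM mulmxA W0 mul0mx.
rewrite -[RHS]mul1mx -[X in X *m M](subrK (proj_ortho E)).
by rewrite mulmxDl PM PcM add0r.
Qed.

Lemma expr_resolution (k : nat) : A ^+ k = \sum_i th i ^+ k *: Q i.
Proof.
elim: k => [|k IHk].
  by rewrite expr0 -[1]/(1%:M) -sumQ; apply: eq_bigr => i _; rewrite scale1r.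
rewrite exprS IHk -[_ * _]/(_ *m _) mulmx_sumr; apply: eq_bigr => i _.
by rewrite -scalemxAr AQ scalerA exprSr.
Qed.

End Eigenprojection.

(** The partial sums of the matrix series are combinations of the [Q i] with scalar partial sums as
    coefficients, so the limit is taken coefficientwise. *)
Lemma expmx_resolution (C : numClosedFieldType) n (A : 'M[C]_n) (I : finType)
    (th e : I -> C) (Q : I -> 'M[C]_n) (s : C) :
  (forall i, A *m Q i = th i *: Q i) -> \sum_i Q i = 1%:M ->
  (forall i, series (fun k => (k`!%:R)^-1 * (s * th i) ^+ k) @ \oo --> e i) ->
  expmx (s *: A) = \sum_i e i *: Q i.
Proof.
move=> AQ sumQ e_lim; apply/cvg_lim; first exact: norm_hausdorff.
have -> : series (fun k => (k`!%:R)^-1 *: (s *: A) ^+ k) = (fun N =>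
    \sum_i series (fun k => (k`!%:R)^-1 * (s * th i) ^+ k) N *: Q i).
  apply/funext => N; rewrite /series /=.
  under [RHS]eq_bigr do rewrite scaler_suml.
  rewrite exchange_big /=; apply: eq_bigr => k _.
  rewrite (@expr_resolution _ _ _ _ (fun i => s * th i) Q) //.
    by rewrite scaler_sumr; apply: eq_bigr => i _; rewrite scalerA.
  by move=> i; rewrite -scalemxAl AQ scalerA.
apply: cvg_big => [|i _]; first exact: add_continuous.
by apply: cvgZ; [exact: e_lim | exact: cvg_cst].
Qed.

(** * The power series of exp(ix) *)

Section PeakStateTransfer.
Variable R : realType.
Local Notation C := (Cplx R).
Local Notation cpl x := ((x : R)%:C%C : C).

Lemma norm_real_complex (x : R) : `|cpl x| = cpl `|x|.
Proof.
have [x0|x0] := leP 0 x; first by rewrite !ger0_norm // ler0c.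
rewrite (ler0_norm (ltW x0)) -normrN -rmorphN.
by rewrite ger0_norm // ler0c oppr_ge0 ltW.
Qed.

Lemma cvg_real_complex (u : nat -> R) (l : R) :
  u @ \oo --> l -> (fun n => cpl (u n)) @ \oo --> cpl l.
Proof.
move=> /cvgrPdist_lt ul; apply/cvgrPdist_lt => e e0.
(* A positive element of [C] is real, so the tolerance [e] is its own real part. *)
have eE : e = cpl (complex.Re e) by rewrite RRe_real // gtr0_real.
have e'0 : 0 < complex.Re e by rewrite -ltcR -[X in _ < X]eE.
apply: filterS (ul _ e'0) => n un.
by rewrite -rmorphB norm_real_complex eE ltcR.
Qed.

Definition cis (x : R) : C := cpl (cos x) + 'i * cpl (sin x).

Lemma cisD (x y : R) : cis (x + y) = cis x * cis y.
Proof.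
rewrite /cis cosD sinD !rmorphB !rmorphD !rmorphM /=.
have := @sqrCi C; set a := cpl _ => ii; ring: ii.
Qed.

Lemma cvg_cis (x : R) :
  series (fun k => (k`!%:R)^-1 * ('i * cpl x) ^+ k) @ \oo --> cis x.
Proof.
have -> : series (fun k => (k`!%:R)^-1 * ('i * cpl x) ^+ k) =
    (fun n => cpl (series (cos_coeff x) n) + 'i * cpl (series (sin_coeff x) n)).
  apply/funext => n; rewrite /series /= !rmorph_sum mulr_sumr -big_split /=.
  apply: eq_bigr => k _; rewrite /cos_coeff /sin_coeff /=.
  rewrite -!exprnP !rmorphM !fmorphV !rmorphXn !rmorph_nat !rmorphN1 /=.
  have i2 h : 'i ^+ h.*2 = (-1) ^+ h :> C by rewrite -muln2 mulnC exprM sqrCi.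
  rewrite exprMn -(odd_double_half k); move: k./2 => h.
  (* Even indices feed only the cosine and odd ones only the sine, the other coefficient being 0. *)
  case: (odd k); rewrite ?add1n ?add0n /= odd_double /= ?doubleK ?exprS i2.
    by rewrite mul0r mul1r; ring.
  by rewrite mul0r mul1r; ring.
apply: cvgD.
  by apply: cvg_real_complex; rewrite unlock; apply: is_cvg_series_cos_coeff.
apply: cvgM; first exact: cvg_cst.
by apply: cvg_real_complex; rewrite unlock; apply: is_cvg_series_sin_coeff.
Qed.

End PeakStateTransfer.

(** * Peak state transfer from kernels resolving the identity *)

Section PeakResolution.
Variable R : realType.
Local Notation C := (Cplx R).
Local Notation cpl x := ((x : R)%:C%C : C).

Lemma norm_cis (x : R) : `|cis x| = 1.
Proof.
have -> : cis x = (cos x +i* sin x)%C by rewrite [RHS]complexE complexiE.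
by rewrite normc_def /= cos2Dsin2 sqrtr1.
Qed.

(* The eigenvalues [th i] may repeat: since the entries at (v, u) all acquire
   the phase [cis c], those of kernels with a common eigenvalue add up without
   cancellation. *)
Definition peak_resolved (X : sgraph) (tau : R) (u v : X) (s : R) : Prop :=
  exists (I : finType) (th : I -> int) (P : I -> X -> X -> R) (c : R),
  [/\ forall i x y, P i x y = P i y x,
      forall i x y, \sum_z (adj x z)%:R * P i z y = (th i)%:~R * P i x y,
      forall x y, \sum_i P i x y = (x == y)%:R,
      forall i, cis (tau * (th i)%:~R) * cpl (P i v u) =
                cis c * cpl `|P i v u|
    & \sum_i `|P i v u| = s].

Lemma adjacency_mx_tr (X : sgraph) : (adjacency_mx C X)^T = adjacency_mx C X.
Proof. by apply/matrixP=> a b; rewrite !mxE adj_sym. Qed.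

Section Transfer.
Variables (X : sgraph) (I : finType) (th : I -> int) (P : I -> X -> X -> R).
Hypothesis P_sym : forall i x y, P i x y = P i y x.
Hypothesis P_adj :
  forall i x y, \sum_z (adj x z)%:R * P i z y = (th i)%:~R * P i x y.
Hypothesis P_sum : forall x y, \sum_i P i x y = (x == y)%:R.
Local Notation A := (adjacency_mx C X).

Definition kernel_mx (i : I) : 'M[C]_#|X| :=
  \matrix_(a, b) cpl (P i (enum_val a) (enum_val b)).

Lemma kernel_mx_tr i : (kernel_mx i)^T = kernel_mx i.
Proof. by apply/matrixP=> a b; rewrite !mxE P_sym. Qed.

Lemma kernel_mx_herm i : (kernel_mx i) ^t* = kernel_mx i.
Proof.
rewrite kernel_mx_tr; apply/matrixP=> a b; rewrite !mxE.
by apply/CrealP/complex_realP; eexists.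
Qed.

Lemma adj_kernel_mx i : A *m kernel_mx i = (th i)%:~R *: kernel_mx i.
Proof.
apply/matrixP=> a b; rewrite !mxE.
transitivity (cpl ((th i)%:~R * P i (enum_val a) (enum_val b))).
  rewrite -P_adj rmorph_sum /= (reindex (@enum_val X X)) /=; last first.
    exact/onW_bij/enum_val_bij.
  by apply: eq_bigr => k _; rewrite !mxE rmorphM rmorph_nat.
by rewrite rmorphM rmorph_int.
Qed.

Lemma kernel_mx_adj i : kernel_mx i *m A = (th i)%:~R *: kernel_mx i.
Proof.
by apply: trmx_inj; rewrite trmx_mul adjacency_mx_tr linearZ /= !kernel_mx_tr
  adj_kernel_mx.
Qed.

Lemma sum_kernel_mx : \sum_i kernel_mx i = 1%:M.
Proof.
apply/matrixP=> a b; rewrite summxE mxE -(inj_eq enum_val_inj).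
rewrite -[RHS](rmorph_nat (real_complex R)) -P_sum rmorph_sum.
by apply: eq_bigr => i _; rewrite mxE.
Qed.

Lemma transition_amplitude_kernel (t : R) (u v : X) :
  transition_amplitude t u v = \sum_i cis (t * (th i)%:~R) * cpl (P i v u).
Proof.
rewrite /transition_amplitude /transition_mx.
rewrite (@expmx_resolution C _ A I (fun i => (th i)%:~R)
  (fun i => cis (t * (th i)%:~R)) kernel_mx); last first.
- move=> i; have := @cvg_cis R (t * (th i)%:~R).
  by rewrite rmorphM rmorph_int mulrA.
- exact: sum_kernel_mx.
- exact: adj_kernel_mx.
by rewrite summxE; apply: eq_bigr => i _; rewrite !mxE !enum_rankK.
Qed.

Lemma eigenprojection_entry_kernel (a : C) (u v : X) :
  eigenprojection_entry a u v = \sum_(i | (th i)%:~R == a) cpl (P i v u).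
Proof.
rewrite /eigenprojection_entry.
rewrite (@eigenprojection_resolution C _ A I (fun i => (th i)%:~R) kernel_mx).
- by rewrite summxE; apply: eq_bigr => i _; rewrite !mxE !enum_rankK.
- exact: kernel_mx_adj.
- exact: adj_kernel_mx.
- exact: sum_kernel_mx.
- exact: kernel_mx_herm.
Qed.

Lemma eigenprojection_not_eigenvalue (a : C) :
  ~~ eigenvalue A a -> eigenprojection A a = 0.
Proof.
rewrite negbK => /eqP E0; apply/eqP; rewrite -submx0 -E0.
by rewrite -[X in (X <= _)%MS]mul1mx proj_ortho_sub.
Qed.

Lemma sum_eigenprojection_kernel (u v : X) :
  (forall a, `|eigenprojection_entry a u v| =
     cpl (\sum_(i | (th i)%:~R == a) `|P i v u|)) ->
  \sum_(a \in [set a | eigenvalue A a]) `|eigenprojection_entry a u v| =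
    cpl (\sum_i `|P i v u|).
Proof.
move=> entryE; pose s : seq C := undup [seq (th i)%:~R | i <- enum I].
have s_mem i : (th i)%:~R \in s.
  by rewrite mem_undup; apply/mapP; exists i; rewrite ?mem_enum.
(* Every eigenvalue is some [th i], and a value in [s] that is not an eigenvalue has projection 0,
   so the sum may run over [s]. *)
rewrite (fsbig_widen _ [set` s]); last first.
- move=> a [_ /= /negP na].
  rewrite /eigenprojection_entry eigenprojection_not_eigenvalue //.
  by rewrite mxE normr0.
- move=> a /= /(@eigenvalue_resolution C _ A I (fun i => (th i)%:~R) kernel_mx).
  by case=> //; [exact: adj_kernel_mx | exact: sum_kernel_mx | move=> i <-].
rewrite -fsbig_seq ?undup_uniq //.
under eq_bigr do rewrite entryE.
rewrite -rmorph_sum; congr (_ %:C)%C.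
rewrite (exchange_big_dep xpredT) //=; apply: eq_bigr => i _.
rewrite (eq_bigl (fun a => a == (th i)%:~R)) => [|a]; last by rewrite eq_sym.
by rewrite -big_filter filter_pred1_uniq ?undup_uniq // big_seq1.
Qed.

End Transfer.

Lemma peak_resolved_transfer (X : sgraph) (tau : R) (u v : X) (s : R) :
  peak_resolved tau u v s ->
  peak_state_transfer u v tau /\ `|transition_amplitude tau u v| = cpl s.
Proof.
case=> I [th [P [c [P_sym P_adj P_sum P_phase <-]]]].
(* The common phase excludes cancellation in any partial sum; this serves both the amplitude and the
   single eigenprojection entries. *)
have norm_sum (p : pred I) :
    `|\sum_(i | p i) cis (tau * (th i)%:~R) * cpl (P i v u)| =
    cpl (\sum_(i | p i) `|P i v u|).
  rewrite (eq_bigr _ (fun i _ => P_phase i)) -mulr_sumr -rmorph_sum normrM.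
  by rewrite norm_cis mul1r norm_real_complex ger0_norm ?sumr_ge0.
have ampE : `|transition_amplitude tau u v| = cpl (\sum_i `|P i v u|).
  by rewrite (transition_amplitude_kernel P_adj P_sum) norm_sum.
split; last by [].
rewrite /peak_state_transfer ampE.
rewrite (sum_eigenprojection_kernel P_adj P_sum) // => a.
rewrite (eigenprojection_entry_kernel P_sym P_adj P_sum) -norm_sum.
have [i0 /eqP i0a|none] := pickP (fun i => (th i)%:~R == a :> C); last first.
  by rewrite !big_pred0.
(* For a single eigenvalue the phase is a constant of modulus 1, so inserting it leaves the modulus
   unchanged. *)
have -> : \sum_(i | (th i)%:~R == a) cis (tau * (th i)%:~R) * cpl (P i v u) =
          cis (tau * (th i0)%:~R) * \sum_(i | (th i)%:~R == a) cpl (P i v u).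
  by rewrite mulr_sumr; apply: eq_bigr => i; rewrite -i0a eqr_int => /eqP ->.
by rewrite normrM norm_cis mul1r.
Qed.

Lemma peak_resolved_product (X Y : sgraph) (tau : R) (u v : X) (h k : Y)
    (s t : R) :
  peak_resolved tau u v s -> peak_resolved tau h k t ->
  peak_resolved (X := cartesian_product X Y) tau (u, h) (v, k) (s * t).
Proof.
case=> I [th [P [c [P_sym P_adj P_sum P_phase <-]]]].
case=> J [th' [Q [c' [Q_sym Q_adj Q_sum Q_phase <-]]]].
exists (I * J)%type, (fun ij => th ij.1 + th' ij.2),
  (fun ij p q => P ij.1 p.1 q.1 * Q ij.2 p.2 q.2), (c + c'); split => /=.
- by move=> i x y; rewrite P_sym Q_sym.
- move=> [i j] [x a] [y b] /=; rewrite rmorphD mulrDl addrC.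
  have delta (T : finType) (z0 : T) (f : T -> R) :
      \sum_z (z0 == z)%:R * f z = f z0.
    rewrite (bigD1 z0) //= eqxx mul1r big1 ?addr0 // => z.
    by rewrite eq_sym => /negPf ->; rewrite mul0r.
  (* The adjacency matrix is the Kronecker sum of those of the factors; the two ways of being
     adjacent exclude each other because [adj] is irreflexive. *)
  transitivity (\sum_z1 \sum_z2 (((x == z1)%:R * P i z1 y) *
     ((adj a z2)%:R * Q j z2 b) + ((adj x z1)%:R * P i z1 y) *
     ((a == z2)%:R * Q j z2 b))).
    rewrite pair_bigA; apply: eq_bigr => -[z1 z2] _ /=.
    rewrite /cartesian_adj /=.
    have [->|_] := eqVneq x z1; first by rewrite adj_irr orbF /=; ring.
    by case: (adj x z1) => /=; ring.
  under eq_bigr do rewrite big_split /= -!mulr_sumr.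
  by rewrite big_split /= -!mulr_suml !delta Q_adj P_adj; ring.
- move=> [x a] [y b]; rewrite xpair_eqE -mulnb natrM -P_sum -Q_sum.
  by rewrite big_distrlr pair_bigA.
- move=> [i j] /=; rewrite rmorphD mulrDr !cisD normrM !rmorphM mulrACA.
  by rewrite P_phase Q_phase mulrACA.
- rewrite big_distrlr pair_bigA; apply: eq_bigr => ij _; exact: normrM.
Qed.

End PeakResolution.

(** * Spectral data of [X14] *)

Definition X14_theta (t : nat) : int :=
  nth 0 [:: - 3%:Z; - 2%:Z; - 1%:Z; 2; 14] t.

(* The idempotent of the eigenvalue theta has entries p (h g^-1) / 60 at (g, h);
   row t lists the values of p along [F20_enum] for theta = [X14_theta t]. *)
Definition X14_idempotents : seq (seq int) :=
  [:: [:: 12; 0; -12; 0; 0; -6; 0; 6; -6; 6; 6; -6; -6; 6; 6; -6; 0; -6; 0; 6];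
      [:: 15; 0; 0; 0; 0; 0; 0; -15; 0; 0; 0; 0; 0; -15; 0; 0; 0; 0; 15; 0];
      [:: 12; -8; 12; -8; -8; 2; -8; 2; 2; 2; 2; 2; 2; 2; 2; 2; -8; 2; -8; 2];
      [:: 18; 5; -3; 5; 5; 1; 5; 4; 1; -11; -11; 1; 1; 4; -11; 1; 5; 1; -10;
          -11];
      [:: 3; 3; 3; 3; 3; 3; 3; 3; 3; 3; 3; 3; 3; 3; 3; 3; 3; 3; 3; 3]].

Definition X14_idempotent (t : nat) (x : F20) : int :=
  nth 0 (nth [::] X14_idempotents t) (index x F20_enum).

(** This makes the kernels symmetric, since exchanging g and h inverts h g^-1. *)
Lemma X14_idempotentV (t : nat) (x : F20) : (t < 5)%N ->
  X14_idempotent t x^-1%g = X14_idempotent t x.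
Proof.
have: all (fun t => all (fun x => X14_idempotent t x^-1%g == X14_idempotent t x)
  F20_enum) (iota 0 5) by vm_cast_no_check (erefl true).
move=> /allP E t5; apply/eqP.
have t_iota : t \in iota 0 5 by rewrite mem_iota.
by move: x (mem_F20_enum x); apply/allP/E.
Qed.

Lemma sum_F20 (V : nmodType) (f : F20 -> V) :
  \sum_x f x = foldr +%R 0 [seq f x | x <- F20_enum].
Proof. by rewrite foldrE big_map (perm_big _ F20_enumE). Qed.

(** The eigenvalue equation as a convolution identity: the neighbours of g are z = s g with s in S,
    and h z^-1 = (h g^-1) s^-1. *)
Lemma X14_idempotent_adj (t : nat) (x : F20) : (t < 5)%N ->
  \sum_s (if s \in X14_elements then X14_idempotent t (x * s^-1)%g else 0) =
  X14_theta t * X14_idempotent t x.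
Proof.
rewrite sum_F20.
have: all (fun t => all (fun x => foldr +%R 0 [seq (if s \in X14_elements
    then X14_idempotent t (x * s^-1)%g else 0) | s <- F20_enum] ==
    X14_theta t * X14_idempotent t x) F20_enum) (iota 0 5)
  by vm_cast_no_check (erefl true).
move=> /allP E t5; apply/eqP.
have t_iota : t \in iota 0 5 by rewrite mem_iota.
by move: x (mem_F20_enum x); apply/allP/E.
Qed.

Lemma X14_idempotent_sum (x : F20) :
  \sum_(t < 5) X14_idempotent t x = if x == 1%g then 60 else 0.
Proof.
have: all (fun x => foldr +%R 0 [seq X14_idempotent t x | t <- iota 0 5] ==
    (if x == 1%g then 60 else 0)) F20_enum by vm_cast_no_check (erefl true).
move=> /allP /(_ x (mem_F20_enum x)) /eqP <-.
by rewrite foldrE big_map -(big_mkord xpredT (fun t => X14_idempotent t x)).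
Qed.

(** These are the (b, 1)-entries, where h g^-1 = 1 b^-1; over 60 they become 0, 0, -2/15, 1/12 and
    1/20. *)
Lemma X14_idempotent_b (t : 'I_5) :
  X14_idempotent t (1 * F20_b^-1)%g = nth 0 [:: 0; 0; -8; 5; 3] t.
Proof.
have: all (fun t => X14_idempotent t (1 * F20_b^-1)%g ==
    nth 0 [:: 0; 0; -8; 5; 3] t) (iota 0 5) by vm_cast_no_check (erefl true).
by move=> /allP/(_ t); rewrite mem_iota ltn_ord => /(_ isT)/eqP.
Qed.

(** * Transfer at time pi/3 *)

Section PeakX14.
Variable R : realType.
Local Notation C := (Cplx R).
Local Notation cpl x := ((x : R)%:C%C : C).
Local Notation tau := (pi / 3 : R).

Lemma cisDpi (x : R) : cis (x + pi) = - cis x.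
Proof. by rewrite /cis cosDpi sinDpi !rmorphN mulrN opprD. Qed.

(** Three times pi/3 is a half turn, so eigenvalues differing by 3 have opposite phases. *)
Lemma cis_tau_add3 (n : int) : cis (tau * (n + 3)%:~R) = - cis (tau * n%:~R).
Proof.
rewrite -cisDpi; congr cis; rewrite rmorphD mulrDr /=; congr (_ + _).
by rewrite divfK // pnatr_eq0.
Qed.

Lemma peak_resolved_X14 :
  peak_resolved (X := X14) tau (1%g : F20) (F20_b : F20) (4 / 15 : R).
Proof.
exists 'I_5, (fun t : 'I_5 => X14_theta t),
  (fun (t : 'I_5) (x y : X14) =>
     (X14_idempotent t ((y : F20) * (x : F20)^-1)%g)%:~R / 60),
  (* The reference phase is that of the eigenvalue 2. *)
  (tau * 2%:~R); split.
- by move=> t x y; rewrite -(X14_idempotentV _ (ltn_ord t)) invMg invgK.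
- move=> t x y; rewrite mulrA -rmorphM -(X14_idempotent_adj _ (ltn_ord t)).
  rewrite rmorph_sum mulr_suml (reindex_inj (mulIg (x : F20))).
  apply: eq_bigr => s _; rewrite X14_adjE mulgK invMg !mulgA.
  by case: ifP => _; rewrite ?mul1r // !mul0r.
- move=> x y; rewrite -mulr_suml -rmorph_sum X14_idempotent_sum.
  rewrite -eq_mulgV1 [in RHS]eq_sym.
  by case: ifP => _; rewrite ?mul0r // divff // pnatr_eq0.
(* The eigenvalue -1 = 2 - 3 has the opposite phase, which offsets its negative entry, and 14 = 2 +
   12 has the same phase. *)
- have c2 : cis (tau * (-1)%:~R) = - cis (tau * 2%:~R).
    by rewrite (_ : 2 = -1 + 3) // cis_tau_add3 opprK.
  have c14 : cis (tau * 14%:~R) = cis (tau * 2%:~R).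
    by rewrite (_ : 14 = 2 + 3 + 3 + 3 + 3) // !cis_tau_add3 !opprK.
  move=> t; rewrite X14_idempotent_b; case: t => -[|[|[|[|[|//]]]]] _ /=.
  + by rewrite mul0r normr0 !rmorph0 !mulr0.
  + by rewrite mul0r normr0 !rmorph0 !mulr0.
  + rewrite ler0_norm; last by lra.
    by rewrite c2 mulNr -mulrN -rmorphN.
  + by rewrite ger0_norm //; lra.
  + by rewrite c14 ger0_norm //; lra.
(* The absolute values add up to (8 + 5 + 3) / 60 = 4/15. *)
- under eq_bigr do rewrite X14_idempotent_b.
  rewrite !big_ord_recl big_ord0 /= mul0r normr0.
  by rewrite ler0_norm ?ger0_norm; lra.
Qed.

Lemma peak_resolved_complete1 (t : R) :
  peak_resolved (X := complete_graph 1) t ord0 ord0 1.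
Proof.
exists unit, (fun _ => 0), (fun _ _ _ => 1), 0; split.
- by [].
- move=> _ x y; rewrite mul0r big1 // => z _.
  by rewrite (ord1 x) (ord1 z) mul0r.
- by move=> x y; rewrite (ord1 x) (ord1 y) eqxx big_const card_unit /= addr0.
- by move=> _; rewrite mulr0 normr1.
- by rewrite big_const card_unit /= addr0 normr1.
Qed.

Lemma peak_resolved_complete6 :
  peak_resolved (X := complete_graph 6) tau ord0 ord0 1.
Proof.
(* With J the all-ones matrix, the idempotents are J/6 for the eigenvalue 5 and 1 - J/6 for -1. *)
exists bool, (fun b => if b then 5 else - 1%:Z),
  (fun b x y => if b then 6^-1 else (x == y)%:R - 6^-1), (tau * 5%:~R); split.
- by move=> [] x y //; rewrite eq_sym.
- move=> b x y.
  have adjE (f : 'I_6 -> R) :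
      \sum_z (@adj (complete_graph 6) x z)%:R * f z = \sum_z f z - f x.
    apply: (addrI (f x)); rewrite addrCA subrr addr0 [RHS](bigD1 x) //.
    congr (_ + _).
    rewrite [LHS](bigD1 x) // adj_irr mul0r /= add0r.
    apply: eq_bigr => z zx; rewrite /complete_adj eq_sym zx mul1r //.
  rewrite adjE; case: b.
    by rewrite sumr_const card_ord -mulr_natr; field.
  rewrite sumrB sumr_const card_ord (bigD1 y) //= eqxx.
  rewrite big1 => [|z /negPf -> //].
  by rewrite -mulr_natr rmorphN /=; move: (x == y)%:R => e; field.
- by move=> x y; rewrite big_bool /= addrC subrK.
(* Both diagonal entries, 1/6 and 5/6, are positive, and 5 = -1 + 6 makes the phases equal. *)
- have c5 : cis (tau * 5%:~R) = cis (tau * (- 1)%:~R).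
    by rewrite (_ : 5 = - 1 + 3 + 3) // !cis_tau_add3 opprK.
  by move=> [] /=; rewrite ?eqxx -?c5; congr (_ * _%:C%C);
    rewrite ger0_norm //; lra.
- by rewrite big_bool /= !ger0_norm; lra.
Qed.

Lemma peak_resolved_hamming (d : nat) :
  exists h : hamming d 6, peak_resolved tau h h 1.
Proof.
elim: d => [|d [h IHd]]; first by exists ord0; apply: peak_resolved_complete1.
exists (ord0, h).
by have := peak_resolved_product peak_resolved_complete6 IHd; rewrite mulr1.
Qed.

Lemma Gamma_peak_state_transfer (d : nat) :
  admits_peak_state_transfer (Gamma d) tau (16 / 225).
Proof.
have [h hP] := peak_resolved_hamming d.
have [pst ampE] :=
  peak_resolved_transfer (peak_resolved_product peak_resolved_X14 hP).
exists ((1%g : F20), h), ((F20_b : F20), h); split; first exact: pst.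
rewrite [X in X ^+ 2]ampE -rmorphXn; congr (_%:C)%C; lra.
Qed.

End PeakX14.

(** * Order of [Gamma] and conclusion *)

Lemma card_Gamma (d : nat) : #|Gamma d| = (20 * 6 ^ d)%N.
Proof. by rewrite [LHS]card_prod card_hamming F20_card. Qed.

Theorem theorem7p5 (R : realType) (d : nat) :
  [/\ #|Gamma d| = (20 * 6 ^ d)%N,
      admits_peak_state_transfer (Gamma d) (pi / 3 : R)%R (16 / 225 : R)%R,
      forall K : finGroupType,
        is_cayley_graph_over (Gamma d) K -> surjects_onto K F20
    & forall K : finGroupType,
        is_cayley_graph_over (Gamma d) K -> ~~ abelian [set: K]%SET].
Proof.
split.
- exact: card_Gamma.
- exact: Gamma_peak_state_transfer.
- by move=> K; apply: Gamma_cayley_surjects.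
- move=> K /Gamma_cayley_surjects K_F20.
  exact: surjects_onto_nonabelian K_F20 F20_nonabelian.
Qed.
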